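(* The following two statements are equivalent. (i) For every orientable signed ribbon graph $G$ and every $A\subseteq E(G)$, when $xyz^2=1$, $$(yz)^{v(G)}R_s(G;x,y,z)=(yz)^{v(G^A)}R_s(G^A;x,y,z),$$ where $G^A$ is the partial dual of $G$ with respect to $A$ and $R_s$ is the signed ribbon graph polynomial. (ii) For every orientable signed ribbon graph $G$ and every $A\subseteq E(G)$, $$P\left(\mathcal{L}_G;X,Y\right)=P\left(\mathcal{L}_{G^A};X,Y\right),$$ where $\mathcal{L}_G$ and $\mathcal{L}_{G^A}$ are the link diagrams on the surfaces $G$ and $G^A$ associated with these signed ribbon graphs, and $P$ is the homfly polynomial of links in thickened orientable surfaces.
   Context: **Ribbon graphs.** A ribbon graph $G=(V(G),E(G))$ is a surface with boundary represented as a union of closed disks (vertices) and ribbons $I\times I$, $I=[0,1]$ (edges), such that: vertices and edges intersect in disjoint line segments $\{0,1\}\times I$; each such segment lies on the boundary of precisely one vertex and precisely one edge; every edge contains exactly two such segments. Ribbon graphs are considered up to homeomorphisms preserving the vertex-edge structure. $G$ is orientable if its underlying surface is. $G$ is signed if equipped with a map $E(G)\to\{+,-\}$. **Arrow presentations.** An arrow presentation is a set of circles (cycles) with disjoint labelled arrows marked along them, each label appearing on precisely two arrows; it is signed if each label carries a sign. Two arrow presentations are equivalent if they differ by reversing both arrows of some of the labels, or by renaming labels. The corresponding (signed) ribbon graph is obtained by letting each cycle bound a vertex disk and, for each label, attaching an edge $I\times I$ with oriented boundary by identifying $\{0\}\times I$ and $\{1\}\times I$ with the two arrows with that label, so that the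 boundary orientation of the edge agrees with the direction of the arrows; the edge inherits the sign of the label. **Partial dual.** Let $G$ be a signed ribbon graph and $A\subseteq E(G)$. Arbitrarily label each edge of $G$ and orient its boundary. The boundary components of the spanning ribbon subgraph $(V(G),A)$ (embedded in $G$) meet the edges of $G$ in disjoint arcs (for $e\in A$, the two sides of $e$ not attached to vertices; for $e\notin A$, the two segments where $e$ is attached to vertices). On each arc place an arrow pointing in the direction of the orientation of the edge it meets, labelled by that edge. If $e$ has sign $\varepsilon$, the label $e$ gets sign $-\varepsilon$ if $e\in A$ and $\varepsilon$ if $e\notin A$. The boundary components of $(V(G),A)$ with these arrows form a signed arrow presentation; the corresponding signed ribbon graph is the partial dual $G^A$. If $G$ is orientable then so is $G^A$. **Signed ribbon graph polynomial.** For a signed ribbon graph $G$ let $v(G)=|V(G)|$, $e(G)=|E(G)|$, $k(G)$ the number of connected components, $\partial(G)$ the number of boundary components, $r(G)=v(G)-k(G)$, $n(G)=e(G)-r(G)$, and $e_\pm(G)$ the number of positive/negative edges. Let $\mathcal{F}(G)$ be the set of the $2^{e(G)}$ spanning signed ribbon subgraphs of $G$ (obtained by deleting subsets of edges). Then $$R_s(G;x,y,z)=\sum_{F\in\mathcal{F}(G)}x^{r(G)-r(F)+s(F)}\,y^{n(F)-s(F)}\,z^{k(F)-\partial(F)+n(F)},\qquad s(F)=\tfrac12\bigl(e_-(F)-e_-(G-F)\bigr),$$ where $e_-(G-F)$ is the number of negative edges of $G$ not in $F$. It is an element of $\mathbb{Z}[x^{\pm1/2},y^{\pm1/2},z^{\pm1}]$.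 ''When $xyz^2=1$'' is understood with compatible square roots, i.e. $x^{1/2}y^{1/2}z=1$. **Homfly polynomial.** Let $\Sigma$ be an orientable (oriented) surface. Links in $\Sigma\times I$ are oriented, considered up to isotopy, and represented by diagrams on $\Sigma$. The homfly polynomial $P(L)=P(L;X,Y)\in\mathbb{Z}[X^{\pm1},Y^{\pm1}]$ is the unique polynomial invariant determined by $$X\,P(L_+)-X^{-1}P(L_-)=Y\,P(L_0),\qquad P(\mathcal{D})=\left(\frac{X-X^{-1}}{Y}\right)^{k-1}$$ for every $k$-component descending link $\mathcal{D}$, where $L_+,L_-,L_0$ are diagrams identical except in one region, where $L_+$ has a positive crossing, $L_-$ a negative crossing, and $L_0$ the orientation-respecting smoothing. (A crossing is positive if the direction of the over-strand is rotated counterclockwise through an angle less than $\pi$ to the direction of the under-strand.) Let $p_\Sigma$, $p_I$ denote the projections of $\Sigma\times I$; $p_I$ is called the height. A knot in $\Sigma\times I$ is descending if it is isotopic to a knot $K'$ having a basepoint $a$ such that, travelling along $K'$ from $a$ in the direction of its orientation, the height decreases until a point $a'$ with $p_\Sigma(a')=p_\Sigma(a)$ is reached, from which $K'$ returns to $a$ by increasing the height while keeping the projection to $\Sigma$ constant. The product of two links is obtained by stacking: one is placed in $\Sigma\times[1/2,1]$, the other in $\Sigma\times[0,1/2]$. A link is descending if it is isotopic to a product of descending knots. **The link $\mathcal{L}_G$.** Let $G$ be an orientable signed ribbon graph, with a chosen orientation of its surface. $\mathcal{L}_G$ is the following link diagram on $G$, representing a link in $G\times I$. Away from the edges it follows the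 boundaries of the vertex disks, oriented as the boundary of the vertex (counterclockwise). Draw an edge horizontally, with its vertex ends on the left and on the right; there are four ends of the diagram at the edge: bottom-left (incoming), top-left (outgoing), top-right (incoming), bottom-right (outgoing). At a $+$ edge, the diagram consists of one simple arc from bottom-left to top-left and one simple arc from top-right to bottom-right which clasp inside the edge, i.e. cross each other exactly twice, both crossings positive. At a $-$ edge, the diagram consists of one simple arc from top-right to top-left and one simple arc from bottom-left to bottom-right which clasp, i.e. cross each other exactly twice, both crossings positive. A vertex with no incident edges contributes a closed curve parallel to its boundary.
   Formalization: The value of P is required only on products of descending knots with pairwise disjoint projections: requiring it on every descending link is contradictory (two curves meeting once on a torus would give (X-X^-1)^2=Y^2). P is any invariant meeting these conditions, valued in Q(X,Y). *)

(* Defs.v *)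
(* MathComp. *)
From HB Require Import structures.
From mathcomp Require Import all_boot all_order all_algebra.

Set Implicit Arguments.
Unset Strict Implicit.
Unset Printing Implicit Defensive.

Import GRing.Theory.

(* The arrows of an arrow presentation are the pairs (e, i), where e is a label
   and i numbers the two arrows labelled e.  A point (e, i, t) is an end of the
   arrow (e, i): its tail if t = false, its head if t = true. *)
Definition point (E : finType) : Type := (E * bool * bool)%type.

(* Circles without arrows are counted by [isolated] (isolated vertices).  The
   other circles are recorded by [arc], which sends an end of an arrow to the
   other extremity of the piece of circle, containing no arrow, that starts
   there; on a circle with a single arrow it swaps the two ends of this arrow.
   No circle carries a direction, and the surface may be non-orientable.
   The sign of e is + if [sign e] is true and - otherwise. *)
Record ribbon_graph := RibbonGraph {
  edge : finType;
  sign : edge -> bool;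
  arc : point edge -> point edge;
  isolated : nat;
  arcK : involutive arc;
  arc_neq : forall p, arc p != p
}.

Section Points.
Variable E : finType.
Implicit Type p : point E.

Definition label p : E := p.1.1.

Definition other_end p : point E := (p.1, ~~ p.2).

(* The boundary of the ribbon e runs along the arrow (e, 0), then from its head
   to the tail of (e, 1), along (e, 1), and from its head to the tail of (e, 0):
   [side p] is the other extremity of the free side of the ribbon starting
   at p. *)
Definition side p : point E := (p.1.1, ~~ p.1.2, ~~ p.2).

Lemma other_endK : involutive other_end.
Proof. by case=> -[e i] t; rewrite /other_end /= negbK. Qed.

Lemma sideK : involutive side.
Proof. by case=> -[e i] t; rewrite /side /= !negbK. Qed.

End Points.

Section RibbonGraph.
Variable G : ribbon_graph.
Implicit Types (F A : {set edge G}) (p q : point (edge G)).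

Definition nvertices : nat :=
  n_comp [rel p q | (q == arc p) || (q == other_end p)]
         [pred p : point (edge G) | true] + isolated G.

Definition ncomponents F : nat :=
  n_comp [rel p q | [|| q == arc p, q == other_end p |
                        (label p \in F) && (q == side p)]]
         [pred p : point (edge G) | true] + isolated G.

(* Where a ribbon outside F was attached, the boundary of (V(G), F) follows the
   arrow; where a ribbon of F is attached it follows the sides of the ribbon. *)
Definition nboundaries F : nat :=
  n_comp [rel p q | (q == arc p) ||
                    (q == if label p \in F then side p else other_end p)]
         [pred p : point (edge G) | true] + isolated G.

Definition nnegative F : nat := #|[set e in F | ~~ sign e]|.

Local Open Scope ring_scope.

Definition rank F : int := nvertices%:Z - (ncomponents F)%:Z.
Definition nullity F : int := #|F|%:Z - rank F.

(* Twice s(F). *)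
Definition twice_s F : int := (nnegative F)%:Z - (nnegative (~: F))%:Z.

(* The signed ribbon graph polynomial R_s(G; x, y, z), evaluated at
   x = sx ^+ 2 and y = sy ^+ 2: the arguments sx and sy stand for the square
   roots x^(1/2) and y^(1/2). *)
Definition Rs (R : comUnitRingType) (sx sy z : R) : R :=
  \sum_(F : {set edge G})
     sx ^ (2 * (rank [set: edge G] - rank F) + twice_s F)
   * sy ^ (2 * nullity F - twice_s F)
   * z ^ ((ncomponents F)%:Z - (nboundaries F)%:Z + nullity F).

Local Close Scope ring_scope.

(* The end of an arrow of the partial dual, as a point of G.  For e in A the new
   arrow (e, i) lies along the side of the ribbon e going from the head of the
   old arrow (e, i) to the tail of the other one; for e outside A the arrows are
   the old ones. *)
Definition dual_point A p : point (edge G) :=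
  if label p \in A then (p.1.1, p.1.2 (+) p.2, ~~ p.2) else p.

Definition dual_point_inv A p : point (edge G) :=
  if label p \in A then (p.1.1, p.1.2 (+) ~~ p.2, ~~ p.2) else p.

Lemma dual_pointK A : cancel (dual_point A) (dual_point_inv A).
Proof.
case=> -[e i] t; rewrite /dual_point /label /=; case: (boolP (e \in A)) => eA.
  by rewrite /dual_point_inv /label /= eA !negbK addbK.
by rewrite /dual_point_inv /label /= (negbTE eA).
Qed.

Lemma dual_point_invK A : cancel (dual_point_inv A) (dual_point A).
Proof.
case=> -[e i] t; rewrite /dual_point_inv /label /=; case: (boolP (e \in A)) => eA.
  by rewrite /dual_point /label /= eA !negbK addbK.
by rewrite /dual_point /label /= (negbTE eA).
Qed.

Definition dual_arc A p := dual_point_inv A (arc (dual_point A p)).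

Lemma dual_arcK A : involutive (dual_arc A).
Proof. by move=> p; rewrite /dual_arc dual_point_invK arcK dual_pointK. Qed.

Lemma dual_arc_neq A p : dual_arc A p != p.
Proof.
apply/eqP => /(congr1 (dual_point A)); rewrite dual_point_invK.
exact/eqP/arc_neq.
Qed.

Definition partial_dual A : ribbon_graph :=
  RibbonGraph (fun e => (e \in A) (+) sign e) (isolated G)
              (@dual_arcK A) (@dual_arc_neq A).

(* An orientation of the surface orients the boundaries of the vertex disks
   (counterclockwise); [enter o p] holds if, along this orientation, p is where
   an arrow begins, so that arrows and arcs alternate.  The orientations of two
   disks joined by a ribbon are compatible if each side of the ribbon joins a
   point where an arrow begins to a point where an arrow ends. *)
Record orientation := Orientation {
  enter : point (edge G) -> bool;
  enter_arc : forall p, enter (arc p) = ~~ enter p;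
  enter_other_end : forall p, enter (other_end p) = ~~ enter p;
  enter_side : forall p, enter (side p) = ~~ enter p
}.

Definition orientable : Prop := inhabited orientation.

End RibbonGraph.

Lemma partial_dual_orientable (G : ribbon_graph) (A : {set edge G}) :
  orientable G -> orientable (partial_dual A).
Proof.
case=> o; split.
apply: (@Orientation (partial_dual A) (fun p => enter o (dual_point A p)))
  => [p|p|p] /=.
- by rewrite dual_point_invK enter_arc.
- case: p => -[e i] t; rewrite /dual_point /label /=.
  case: ifP => _; last by rewrite -enter_other_end.
  by rewrite -enter_side /side /= -addbN.
- case: p => -[e i] t; rewrite /dual_point /label /=.
  case: ifP => _; last by rewrite -enter_side.
  by rewrite -enter_other_end /other_end /= addNb addbN negbK.
Qed.

(* A cellulated compact oriented surface: a vertex disk for each cycle of [rot]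
   (the next dart counterclockwise around the vertex), a band for each pair
   {d, flip d}, and a face disk for each cycle of [fun d => flip (rot d)] that is
   not a hole.  The face of d is the one lying to the left of d; flip (rot d)
   is the dart preceding d along the boundary of this face, and the corner of
   this face at d is the one between d and rot d.  The holes are the boundary
   components of the surface. *)
Record surface := Surface {
  dart :> finType;
  rot : dart -> dart;
  flip : dart -> dart;
  hole : dart -> bool;
  rot_inj : injective rot;
  flipK : involutive flip;
  flip_neq : forall d, flip d != d;
  hole_face : forall d, hole (flip (rot d)) = hole d
}.

Definition same_vertex (S : surface) (d e : S) : bool := fconnect (@rot S) d e.

Definition same_face (S : surface) (d e : S) : bool :=
  fconnect (fun x : S => flip (rot x)) d e.

Definition in_edge (S : surface) (d e : S) : bool := (e == d) || (e == flip d).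

Section DiagramData.
Variables (S : surface) (out : S -> bool) (turn : S -> S).

Definition is_on (d : S) : bool := out d || out (flip d).

(* Two strands at a vertex with exactly four darts, joining opposite ones. *)
Definition is_crossing (d : S) : bool :=
  [&& is_on d, is_on (rot d) & turn d == rot (rot d)].

End DiagramData.

(* An oriented link diagram.  A strand passes at most once along a band; [out d]
   holds if some strand leaves the vertex of d through d.  Inside a vertex disk
   the strands are chords: the chord starting at d ends at [turn d].  A disk
   with more than two chord ends has exactly four darts, all of them chord ends,
   so it contains at most one crossing; [over d] then tells whether the chord of
   d is the upper one.  Chords of a vertex disk that join neighbouring darts are
   disjoint.  The values of [turn] off the strands and of [over] away from the
   crossings are irrelevant. *)
Record diagram (S : surface) := Diagram {
  out : S -> bool;
  turn : S -> S;
  over : S -> bool;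
  out_flip : forall d, out d -> ~~ out (flip d);
  turn_vertex : forall d, is_on out d -> same_vertex d (turn d);
  turn_on : forall d, is_on out d -> is_on out (turn d);
  turnK : forall d, is_on out d -> turn (turn d) = d;
  out_turn : forall d, is_on out d -> out (turn d) = ~~ out d;
  vertex_strands : forall d e, is_on out d -> is_on out e -> same_vertex d e ->
    [|| e == d, e == turn d | order (@rot S) d == 4];
  over_turn : forall d, is_crossing out turn d -> over (turn d) = over d;
  over_rot : forall d, is_crossing out turn d -> over (rot d) = ~~ over d
}.

Section Diagram.
Variables (S : surface) (D : diagram S).

Definition on (d : S) : bool := is_on (out D) d.
Definition crossing (d : S) : bool := is_crossing (out D) (turn D) d.

(* From a dart through which a strand leaves a vertex to the next one. *)
Definition step (d : S) : S := if out D d then turn D (flip d) else d.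

Definition nlink : nat := fcard step [pred d | out D d].

(* Each strand through a crossing is designated by the dart through which it
   leaves the crossing.  The link is travelled along component by component,
   from the highest one to the lowest one, starting on each component from a
   base point situated just before the vertex of the corresponding element of
   bs; every crossing is first met on its upper strand. *)
Definition descending_diagram : Prop :=
  exists bs : seq S, let s := flatten [seq orbit step b | b <- bs] in
  [/\ uniq s, s =i [pred d | out D d] &
      forall d e, crossing d -> out D d -> over D d ->
        same_vertex d e -> out D e -> e != d -> index d s < index e s].

(* Distinct components of the link do not cross each other. *)
Definition disjoint_projections : Prop :=
  forall d e, crossing d -> out D d -> out D e -> same_vertex d e ->
    fconnect step d e.

End Diagram.

Section SameSurface.
Variables (S : surface) (D D' : diagram S).

Definition agree_at (d : S) : Prop :=
  (on D d -> turn D' d = turn D d) /\ (crossing D d -> over D' d = over D d).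

(* All corners of the face of k other than those in ks are corners of strands,
   i.e. at these corners the strand follows the boundary of the face. *)
Definition strand_corners (k : S) (ks : seq S) : Prop :=
  forall d, same_face k d -> d \notin ks -> on D d && (turn D (rot d) == d).

Definition on_face_boundary (k d : S) : bool :=
  same_face k d || same_face k (flip d).

(* A strand leaves the crossing of k, runs once around a face disk and comes back
   to this crossing through the next dart; in D' this loop is erased. *)
Definition reidemeister1 : Prop :=
  exists k : S,
  [/\ ~~ hole k, crossing D k & strand_corners k [:: k]] /\
  [/\ forall d, out D' d = out D d && ~~ on_face_boundary k d,
      turn D' (turn D k) = turn D (rot k) &
      forall d, ~~ on_face_boundary k d -> ~~ same_vertex k d -> agree_at d].

(* A face disk bounded by two strands, one of which is above the other at the
   two crossings; in D' each strand follows the part of the boundary of the face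
   previously followed by the other one, and the crossings have disappeared.
   The orientation of D' along the boundary of the face is forced by out_turn. *)
Definition reidemeister2 : Prop :=
  exists p q : S,
  [/\ ~~ hole p, same_face p q, ~~ same_vertex p q & strand_corners p [:: p; q]] /\
  [/\ crossing D p, crossing D q & over D p = over D (rot q)] /\
  [/\ forall d, on D' d = on D d,
      forall d, ~~ on_face_boundary p d -> out D' d = out D d,
      turn D' p = turn D (rot p) /\ turn D' (rot p) = turn D p,
      turn D' q = turn D (rot q) /\ turn D' (rot q) = turn D q &
      forall d, ~~ same_vertex p d -> ~~ same_vertex q d -> agree_at d].

End SameSurface.

Section TwoSurfaces.
Variables (S T : surface) (D : diagram S) (D' : diagram T).

Definition homeomorphic : Prop :=
  exists f : S -> T,
  [/\ bijective f, forall d, f (rot d) = rot (f d),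
      forall d, f (flip d) = flip (f d) & forall d, hole (f d) = hole d] /\
  [/\ forall d, out D' (f d) = out D d,
      forall d, on D d -> turn D' (f d) = f (turn D d) &
      forall d, crossing D d -> over D' (f d) = over D d].

(* T has the darts of S except d and flip d. *)
Definition edge_removal (d : S) (f : T -> S) : Prop :=
  [/\ injective f, forall x, (x \in codom f) = ~~ in_edge d x,
      forall x, f (flip x) = flip (f x) &
      ~~ (in_edge d (rot d) && in_edge d (rot (flip d)))].

(* First value outside the edge of d among x, h x and h (h x). *)
Definition skip (d : S) (h : S -> S) (x : S) : S :=
  if in_edge d x then
    let y := h x in if in_edge d y then h y else y
  else x.

(* The edge of d joins distinct vertices; their disks and the band are merged
   into one vertex disk, and a strand along the band is merged with the chords
   which it joins. *)
Definition contraction : Prop :=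
  exists (d : S) (f : T -> S),
  [/\ edge_removal d f, ~~ same_vertex d (flip d),
      forall x, f (rot x) = skip d (fun y => rot (flip y)) (rot (f x)) &
      forall x, hole x = hole (f x)] /\
  [/\ forall x, out D' x = out D (f x),
      forall x, on D' x ->
        f (turn D' x) = skip d (fun y => turn D (flip y)) (turn D (f x)) &
      forall x, crossing D (f x) -> over D' x = over D (f x)].

(* The edge of d meets no strand and separates two distinct faces, at most one of
   which is a hole; these faces are merged (with a hole, this is a collapse of
   a part of the surface along its boundary). *)
Definition deletion : Prop :=
  exists (d : S) (f : T -> S),
  [/\ edge_removal d f, ~~ same_face d (flip d), ~~ (hole d && hole (flip d)),
      forall x, f (rot x) = skip d (@rot S) (rot (f x)) &
      forall x, hole x =
        if same_face d (f x) || same_face (flip d) (f x)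
        then hole d || hole (flip d) else hole (f x)] /\
  [/\ ~~ on D d, forall x, out D' x = out D (f x),
      forall x, on D' x -> f (turn D' x) = turn D (f x) &
      forall x, crossing D (f x) -> over D' x = over D (f x)].

(* A triangular face disk with vertices 0, 1, 2 (counterclockwise).  Around the
   crossing i the darts are x i (towards i + 1), y i (towards i - 1), and the
   outer darts u i and v i, opposite to x i and y i.  The strand i follows
   u i, x i, y (i + 1), v (i + 1) in this order or the opposite one; it meets the
   strand i - 1 at the crossing i.  It is excluded that each strand is above the
   next one, or that each one is below the next one.  In D' the strand i meets
   the strand i + 1 first, starting from u i: it follows u i, y (i + 1), x i,
   v (i + 1). *)
Definition reidemeister3 : Prop :=
  exists (f : S -> T) (x : 'I_3 -> S),
  let y i := rot (x i) in
  let u i := rot (y i) in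
  let v i := rot (u i) in
  let at_triangle d := [exists i, same_vertex (x i) d] in
  [/\ forall i, crossing D (x i), forall i, flip (x i) = y (i + 1)%R,
      forall i, ~~ hole (x i), forall i j, i != j -> ~~ same_vertex (x i) (x j) &
      exists i j, over D (x i) != over D (x j)] /\
  [/\ bijective f, forall d, f (flip d) = flip (f d),
      forall d, ~~ at_triangle d -> f (rot d) = rot (f d),
      forall i, [/\ rot (f (x i)) = f (y i),
                    rot (f (y i)) = f (v (i + 1)%R),
                    rot (f (v (i + 1)%R)) = f (u (i - 1)%R) &
                    rot (f (u (i - 1)%R)) = f (x i)] &
      forall d, (forall i, d != y i) -> hole (f d) = hole d] /\
  [/\ forall d, out D' (f d) =
        out D d (+) [exists i, (d == x i) || (d == y i)],
      forall i, crossing D' (f (x i)) /\ over D' (f (x i)) = over D (x i),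
      forall d, on D d -> ~~ at_triangle d -> turn D' (f d) = f (turn D d) &
      forall d, crossing D d -> ~~ at_triangle d -> over D' (f d) = over D d].

End TwoSurfaces.

(* Isotopy of the links represented by two diagrams, in terms of diagrams: the
   equivalence relation generated by the Reidemeister moves and by changes of
   cellulation.  As surfaces are given by cellulations, a surface is only
   considered up to orientation-preserving homeomorphisms. *)
Inductive isotopic :
    forall S T : surface, diagram S -> diagram T -> Prop :=
| IsoHomeo S T (D : diagram S) (D' : diagram T) :
    homeomorphic D D' -> isotopic D D'
| IsoContract S T (D : diagram S) (D' : diagram T) :
    contraction D D' -> isotopic D D'
| IsoDelete S T (D : diagram S) (D' : diagram T) :
    deletion D D' -> isotopic D D'
| IsoR1 S (D D' : diagram S) : reidemeister1 D D' -> isotopic D D'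
| IsoR2 S (D D' : diagram S) : reidemeister2 D D' -> isotopic D D'
| IsoR3 S T (D : diagram S) (D' : diagram T) :
    reidemeister3 D D' -> isotopic D D'
| IsoSym S T (D : diagram S) (D' : diagram T) :
    isotopic D D' -> isotopic D' D
| IsoTrans S T U (D : diagram S) (D' : diagram T) (D'' : diagram U) :
    isotopic D D' -> isotopic D' D'' -> isotopic D D''.

(* The diagrams Dp, Dm and D0 are identical except at the vertex of d, where Dp
   has a positive crossing, Dm has the negative one and D0 is smoothed according
   to the orientation.  The upper strand of Dp leaves through d and the lower one
   through the next dart counterclockwise. *)
Definition skein_triple (S : surface) (Dp Dm D0 : diagram S) (d : S) : Prop :=
  [/\ crossing Dp d, out Dp d, out Dp (rot d) & over Dp d] /\
  [/\ forall e, out Dm e = out Dp e,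
      forall e, on Dp e -> turn Dm e = turn Dp e &
      forall e, crossing Dp e -> over Dm e = over Dp e (+) same_vertex d e] /\
  [/\ forall e, out D0 e = out Dp e,
      turn D0 d = turn Dp (rot d), turn D0 (rot d) = turn Dp d &
      forall e, ~~ same_vertex d e -> agree_at Dp D0 e].

Local Open Scope ring_scope.

(* The field of fractions Q(X, Y) of Z[X, Y]; it contains Z[X^+-1, Y^+-1]. *)
Definition fracXY : fieldType := {fraction {poly {poly int}}}.

Definition XX : fracXY := FracField.tofrac (('X)%:P : {poly {poly int}}).
Definition YY : fracXY := FracField.tofrac ('X : {poly {poly int}}).

(* The isotopy invariants of links in thickened oriented surfaces that satisfy
   the homfly skein relation and take the value ((X - X^-1) / Y)^(k - 1) on a
   product of k >= 1 descending knots.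

   This value cannot be required for every product of descending knots: let a
   and b be simple closed curves meeting exactly once, transversally, on a
   surface of positive genus.  Both "a above b" and "b above a" are products of
   two descending knots; they are L_+ and L_- at the only crossing, and L_0 is a
   simple closed curve, so the skein relation would give
     (X - X^-1) * ((X - X^-1) / Y) = Y.
   The value is therefore required only when the order of the product is
   irrelevant because the knots have pairwise disjoint projections (up to
   isotopy, by [homfly_isotopic]).  Nor is it required that the values be
   Laurent polynomials. *)
Record is_homfly (P : forall S : surface, diagram S -> fracXY) : Prop := {
  homfly_isotopic : forall (S T : surface) (D : diagram S) (D' : diagram T),
    isotopic D D' -> P S D = P T D';
  homfly_skein : forall (S : surface) (Dp Dm D0 : diagram S) (d : S),
    skein_triple Dp Dm D0 d ->
    XX * P S Dp - XX^-1 * P S Dm = YY * P S D0;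
  homfly_descending : forall (S : surface) (D : diagram S) (k : nat),
    descending_diagram D -> disjoint_projections D -> nlink D = k.+1 ->
    P S D = ((XX - XX^-1) / YY) ^+ k
}.

Local Close Scope ring_scope.

Section Link.
Variables (G : ribbon_graph) (o : orientation G).
Implicit Type p : point (edge G).

(* At each ribbon the diagram has two crossings and four ends, which are the four
   points of the ribbon: if p and q are the ends of an arrow and begin and
   end it along the boundary of the vertex, p is incoming and q is outgoing.
   The dart inl (p, true) runs from a crossing towards the end p of the diagram,
   and inl (p, false) is opposite to it at this crossing.  The points p and
   [strand_end p] are the ends of one of the two arcs of the clasp, while p and
   [crossing_end p] are adjacent to the same crossing.  An isolated vertex i
   contributes a closed curve, made of one edge {inr (i, true), inr (i, false)}
   directed along inr (i, true). *)
Definition link_dart : finType :=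
  ((point (edge G) * bool) + ('I_(isolated G) * bool))%type.

Definition strand_end p := if sign (label p) then other_end p else side p.
Definition crossing_end p := if sign (label p) then side p else other_end p.

Definition link_rot (d : link_dart) : link_dart :=
  match d with
  | inl (p, b) => inl (crossing_end p, b (+) (enter o p (+) sign (label p)))
  | inr (i, b) => inr (i, ~~ b)
  end.

Definition link_flip (d : link_dart) : link_dart :=
  match d with
  | inl (p, b) => inl (if b then arc p else strand_end p, b)
  | inr (i, b) => inr (i, ~~ b)
  end.

(* The faces that are not holes are the vertex disks of G and, for each ribbon,
   the bigon of the clasp; each hole is a boundary component of G. *)
Definition link_hole (d : link_dart) : bool :=
  match d with
  | inl (p, b) => enter o p && (b || ~~ sign (label p))
  | inr (_, b) => ~~ b
  end.

Definition link_out (d : link_dart) : bool :=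
  match d with
  | inl (p, b) => b (+) enter o p
  | inr (_, b) => b
  end.

Definition link_turn (d : link_dart) : link_dart :=
  match d with
  | inl (p, b) => inl (p, ~~ b)
  | inr (i, b) => inr (i, ~~ b)
  end.

Definition link_over (d : link_dart) : bool :=
  match d with
  | inl (p, _) => enter o p (+) sign (label p)
  | inr _ => false
  end.

Lemma crossing_endK : involutive crossing_end.
Proof.
move=> p; rewrite /crossing_end; case s: (sign (label p)).
  by rewrite [label _]/(label p) s sideK.
by rewrite [label _]/(label p) s other_endK.
Qed.

Lemma strand_endK : involutive strand_end.
Proof.
move=> p; rewrite /strand_end; case s: (sign (label p)).
  by rewrite [label _]/(label p) s other_endK.
by rewrite [label _]/(label p) s sideK.
Qed.

Lemma crossing_end_label p : label (crossing_end p) = label p.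
Proof. by rewrite /crossing_end; case: ifP. Qed.

Lemma enter_crossing_end p : enter o (crossing_end p) = ~~ enter o p.
Proof.
by rewrite /crossing_end; case: ifP; rewrite ?enter_side ?enter_other_end.
Qed.

Lemma strand_end_label p : label (strand_end p) = label p.
Proof. by rewrite /strand_end; case: ifP. Qed.

Lemma enter_strand_end p : enter o (strand_end p) = ~~ enter o p.
Proof.
by rewrite /strand_end; case: ifP; rewrite ?enter_side ?enter_other_end.
Qed.

Lemma link_rot2 p (b : bool) :
  link_rot (link_rot (inl (p, b))) = inl (p, ~~ b).
Proof.
rewrite /= crossing_endK crossing_end_label enter_crossing_end.
by congr (inl (_, _)); case: b (enter o p) (sign _) => [] [] [].
Qed.

Lemma link_rot4 d : link_rot (link_rot (link_rot (link_rot d))) = d.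
Proof.
by case: d => [[p b]|[i b]]; [rewrite (link_rot2 p b) link_rot2 negbK | rewrite /= !negbK].
Qed.

Lemma link_turnK : involutive link_turn.
Proof. by case=> [[p b]|[i b]] /=; rewrite negbK. Qed.

Lemma link_rot_inj : injective link_rot.
Proof.
apply: (can_inj (g := fun d => link_rot (link_rot (link_rot d)))).
exact: link_rot4.
Qed.

Lemma link_flipK : involutive link_flip.
Proof.
by case=> [[p []]|[i b]] /=; rewrite ?arcK ?strand_endK ?negbK.
Qed.

Lemma link_flip_neq d : link_flip d != d.
Proof.
apply/eqP; case: d => [[p b]|[i b]] /= [].
  case: b => E; have := arc_neq p; have := enter_strand_end p;
  by rewrite E ?eqxx //; case: enter.
by case: b.
Qed.

Lemma link_hole_face d : link_hole (link_flip (link_rot d)) = link_hole d.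
Proof.
case: d => [[p b]|[i b]] /=; last by rewrite negbK.
case E: (b (+) _); last first.
  rewrite enter_strand_end enter_crossing_end negbK strand_end_label.
  rewrite crossing_end_label /=.
  by case: b (enter o p) (sign _) E => [] [] [].
rewrite enter_arc enter_crossing_end negbK orTb andbT.
by case: b (enter o p) (sign _) E => [] [] [].
Qed.

Definition link_surface : surface :=
  Surface link_rot_inj link_flipK link_flip_neq link_hole_face.

Lemma link_out_flip d : link_out (link_flip d) = ~~ link_out d.
Proof.
by case: d => [[p []]|[i b]] //=; rewrite ?enter_arc ?enter_strand_end.
Qed.

Lemma link_on (d : link_surface) : @is_on link_surface link_out d.
Proof. by rewrite /is_on [flip d]/(link_flip d) link_out_flip orbN. Qed.

Lemma link_turn_vertex (d : link_surface) : same_vertex d (link_turn d).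
Proof.
case: d => [[p b]|[i b]]; rewrite /same_vertex.
  rewrite [link_turn _]/= -link_rot2.
  exact: (fconnect_iter (@rot link_surface) 2).
exact: (fconnect1 (@rot link_surface)).
Qed.

Lemma link_out_turn d : link_out (link_turn d) = ~~ link_out d.
Proof. by case: d => [[p b]|[i b]] //=; rewrite addNb. Qed.

Lemma link_order (p : point (edge G)) (b : bool) :
  order (@rot link_surface) (inl (p, b) : link_surface) = 4.
Proof.
pose r := @rot link_surface; pose d : link_surface := inl (p, b).
have np : crossing_end p != p.
  apply/eqP => E; have := enter_crossing_end p.
  by rewrite E; case: enter.
apply: (@order_cycle _ r [:: d; r d; r (r d); r (r (r d))]).
- by rewrite /= !eqxx [r (r _)]link_rot4 eqxx.
- rewrite [r (r d)]link_rot2 /= !inE !negb_or /eq_op /= /eq_op /=.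
  rewrite !(eq_sym p) !(negbTE np) !eqxx /=.
  by case: b {d} (enter o p) (sign _) => [] [] [].
- by rewrite inE eqxx.
Qed.

Lemma link_vertex_strands (d e : link_surface) :
  @is_on link_surface link_out d -> @is_on link_surface link_out e ->
  same_vertex d e ->
  [|| e == d, e == link_turn d | order (@rot link_surface) d == 4].
Proof.
move=> _ _; case: d => [[p b]|[i b]]; first by rewrite link_order !orbT.
rewrite /same_vertex => /iter_findex <-.
elim: (findex _ _ _) => [|n IHn] /=; first by rewrite eqxx.
case/or3P: IHn => [/eqP -> |/eqP -> |->]; last by rewrite !orbT.
  by rewrite eqxx orbT.
by rewrite /= negbK eqxx.
Qed.

Lemma link_over_turn d : link_over (link_turn d) = link_over d.
Proof. by case: d => [[p b]|[i b]]. Qed.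

Lemma link_crossing_over_rot (d : link_surface) :
  @is_crossing link_surface link_out link_turn d ->
  link_over (rot d) = ~~ link_over d.
Proof.
case: d => [[p b] _|[i b]] /=.
  by rewrite enter_crossing_end crossing_end_label addNb.
by rewrite /is_crossing /= negbK => /and3P[_ _ /eqP[]]; case: b.
Qed.

(* The link diagram L_G, on the surface of G oriented by o. *)
Definition link_diagram : diagram link_surface :=
  @Diagram link_surface link_out link_turn link_over
    (fun d h => introN idP (fun h' => negP (etrans (esym (link_out_flip d)) h') h))
    (fun d _ => link_turn_vertex d) (fun d _ => link_on (link_turn d))
    (fun d _ => link_turnK d) (fun d _ => link_out_turn d) link_vertex_strands
    (fun d _ => link_over_turn d) link_crossing_over_rot.

End Link.

(* Main.v *)
(* Both statements hold, for the same reason.  For a spanning subgraph F let N(F)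
   be the number of positive edges in F plus that of negative edges outside F.
   Passing to the partial dual with respect to A and replacing F by its symmetric
   difference with A preserves N(F) and the boundary components of F, so every
   sum over F of a function of N(F) and of the number of boundary components is
   invariant.  When x y z^2 = 1, (y z)^v R_s is x^(-k(G)) times such a sum, and
   k(G) is also the number of components of the partial dual.  The homfly
   polynomial of L_G is such a sum too: the skein relation at one crossing of the
   clasp of an edge gives, up to a Reidemeister move, either an unlinked clasp,
   with weight X^-2, or a smoothed one, with weight X^-1 Y; once all clasps are
   resolved, there remains a diagram without crossings, made of the boundary
   components of a spanning subgraph F with N(F) smoothed edges. *)
From mathcomp Require Import all_boot all_order all_algebra.
From mathcomp Require Import ring zify.
Require Import Defs.

Set Implicit Arguments.
Unset Strict Implicit.
Unset Printing Implicit Defensive.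

Import GRing.Theory.
Local Open Scope ring_scope.

(** * Partial duality and state sums *)

Lemma n_comp_bij (T T' : finType) (h : T' -> T) (e : rel T) (e' : rel T') :
  bijective h -> symmetric e -> (forall x y, e' x y = e (h x) (h y)) ->
  n_comp e' [pred x : T' | true] = n_comp e [pred x : T | true].
Proof.
case=> g hK gK e_sym e'E.
have e'_sym : symmetric e' by move=> x y; rewrite !e'E.
have cl : closed e [pred x : T | true] by [].
have hc := @adjunction_n_comp _ _ h _ _ (sym_connect_sym e_sym)
  (sym_connect_sym e'_sym) _ cl.
rewrite hc; first exact: eq_n_comp_r.
apply: (strict_adjunction (sym_connect_sym e'_sym) cl (can_inj hK)).
  by apply/subsetP => x _; rewrite -(gK x) codom_f.
by move=> x y _; rewrite e'E.
Qed.

(* N(F). *)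
Definition nagree (G : ribbon_graph) (F : {set edge G}) : nat :=
  #|[set e | (e \in F) == sign e]|.

Definition state_sum (V : nmodType) (f : nat -> nat -> V) (G : ribbon_graph) :
    V :=
  \sum_(F : {set edge G}) f (nagree F) (nboundaries F).

Section PartialDual.
Variable G : ribbon_graph.
Implicit Types (A F : {set edge G}) (p q : point (edge G)).

Definition toggle A F : {set edge G} := [set e | (e \in F) (+) (e \in A)].

Lemma toggleK A : involutive (toggle A).
Proof. by move=> F; apply/setP => e; rewrite !inE addbK. Qed.

Definition across F p := if label p \in F then side p else other_end p.

Lemma acrossK F : involutive (across F).
Proof.
move=> p; rewrite /across; case pF: (label p \in F).
  by rewrite [label _]/(label p) pF sideK.
by rewrite [label _]/(label p) pF other_endK.
Qed.

Lemma dual_point_bij A : bijective (@dual_point G A).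
Proof. exact: Bijective (dual_pointK A) (@dual_point_invK _ A). Qed.

Lemma label_dual_point A p : label (dual_point A p) = label p.
Proof. by rewrite /dual_point; case: ifP. Qed.

Lemma dual_point_dual_arc A p :
  dual_point A (dual_arc A p) = arc (dual_point A p).
Proof. by rewrite dual_point_invK. Qed.

(** In the dual, a ribbon with label in [A] is attached along its old free sides, so arrows and free
    sides exchange roles there. *)
Lemma dual_point_other_end A p :
  dual_point A (other_end p) =
  if label p \in A then side (dual_point A p) else other_end (dual_point A p).
Proof.
case: p => -[e i] t; rewrite /dual_point /label /=; case: ifP => // _.
by rewrite /side /= addbN.
Qed.

Lemma dual_point_side A p :
  dual_point A (side p) =
  if label p \in A then other_end (dual_point A p) else side (dual_point A p).
Proof.
case: p => -[e i] t; rewrite /dual_point /label /=; case: ifP => // _.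
by rewrite /other_end /= addbN addNb negbK.
Qed.

Lemma boundary_sym F :
  symmetric [rel p q | (q == arc p) || (q == across F p)].
Proof.
move=> p q /=.
by rewrite !(eq_sym q) (inv_eq (@arcK G)) (inv_eq (acrossK F)).
Qed.

Lemma component_sym F :
  symmetric [rel p q | [|| q == arc p, q == other_end p |
                        (label p \in F) && (q == side p)]].
Proof.
move=> p q /=.
rewrite !(eq_sym q) (inv_eq (@arcK G)) (inv_eq (@other_endK _)).
rewrite (inv_eq (@sideK _)); congr [|| _, _ | _].
by rewrite andbC [RHS]andbC; case: eqP => // ->.
Qed.

(** At a label in [A] two exchanges cancel: that of arrows with free sides, and that of membership
    in the subgraph. Hence [dual_point] carries one boundary relation to the other. *)
Lemma nboundaries_dual A F :
  @nboundaries (partial_dual A) (toggle A F) = nboundaries F.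
Proof.
rewrite /nboundaries (n_comp_bij (dual_point_bij A) (boundary_sym F)).
  by [].
move=> p q /=.
rewrite -dual_point_dual_arc (inj_eq (bij_inj (dual_point_bij A))).
congr (_ || _); rewrite -(inj_eq (bij_inj (dual_point_bij A))); congr (_ == _).
rewrite /across label_dual_point inE.
case: (label p \in F); case pA: (label p \in A).
- by rewrite dual_point_other_end pA.
- by rewrite dual_point_side pA.
- by rewrite dual_point_side pA.
- by rewrite dual_point_other_end pA.
Qed.

(** For the full edge set the relation contains [other_end] and [side] alike, so exchanging them
    leaves it unchanged. *)
Lemma ncomponents_dual A :
  @ncomponents (partial_dual A) [set: edge G] = ncomponents [set: edge G].
Proof.
rewrite /ncomponents (n_comp_bij (dual_point_bij A) (component_sym setT)).
  by [].
move=> p q /=.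
rewrite -dual_point_dual_arc !inE !(inj_eq (bij_inj (dual_point_bij A))) /=.
congr (_ || _).
rewrite -!(inj_eq (bij_inj (dual_point_bij A)) q).
rewrite dual_point_side dual_point_other_end.
by case: ifP => _; first exact: orbC.
Qed.

Lemma nagree_dual A F :
  @nagree (partial_dual A) (toggle A F) = nagree F.
Proof.
apply: eq_card => e; rewrite !inE /=.
by move: (e \in F) (_ \in A) (sign _) => [] [] [].
Qed.

Lemma state_sum_dual (V : nmodType) (f : nat -> nat -> V) A :
  state_sum f (partial_dual A) = state_sum f G.
Proof.
rewrite /state_sum [LHS](reindex_inj (inv_inj (toggleK A))).
by apply: eq_bigr => F _; rewrite nagree_dual nboundaries_dual.
Qed.

(** In subtractive form, 2s(F) = |F| - N(F); this is how N(F) enters the exponents of [Rs]. *)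
Lemma nagree_nnegative F :
  (nagree F + nnegative F)%N = (#|F| + nnegative (~: F))%N.
Proof.
rewrite /nagree /nnegative -(cardsID F) -(cardsID [set e | sign e] F).
rewrite addnAC; congr (_ + _ + _)%N; apply: eq_card => e; rewrite !inE;
  by case: (e \in F); case: (sign e).
Qed.

(** * The ribbon graph polynomial as a state sum *)

Section StateSum.
Variables (R : comUnitRingType) (sx sy z : R).
Hypothesis sxyz : sx * sy * z = 1.

(** Once [sx] is replaced by the inverse of [sy * z], the terms in v(G), k(F) and |F| cancel: y gets
    the exponent k(G) + N(F), and z gets 2k(G) + N(F) minus the number of boundary components of
    F. *)
Lemma Rs_state_sum :
  (sy ^+ 2 * z) ^+ nvertices G * Rs G sx sy z =
  (sy * z) ^+ (2 * ncomponents [set: edge G]) *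
  state_sum (fun n b => (sy ^+ 2 * z) ^+ n * z ^- b) G.
Proof.
have Uy : sy \is a GRing.unit.
  by apply/unitrP; exists (sx * z); split; rewrite -sxyz; ring.
have Uz : z \is a GRing.unit.
  by apply/unitrP; exists (sx * sy); split; rewrite -sxyz; ring.
have sxE : sx = (sy * z)^-1.
  by rewrite -[LHS]mulr1 -(divrr (_ : sy * z \is a GRing.unit)) ?unitrM ?Uy //
     !mulrA sxyz mul1r.
rewrite /Rs /state_sum !mulr_sumr; apply: eq_bigr => F _; rewrite sxE exprz_inv.
rewrite exprMz_comm //; last exact: mulrC.
rewrite /nullity /rank /twice_s.
have := nagree_nnegative F.
move: (nagree F) (nnegative F) (nnegative (~: F)) #|F| (nboundaries F).
move: (nvertices G) (ncomponents F) (ncomponents _) => v k K N m m' f b NE.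
rewrite !exprMn !exprnP exprnN.
set a := - _; set b' := 2 * _ - _; set c := _ - _ + _.
(* Powers of [sy] and of [z] are gathered separately, which leaves two linear identities between
   exponents. *)
transitivity (sy ^ (v%:Z + v%:Z + a + b') * z ^ (v%:Z + a + c)).
  by rewrite !exprzDr //; ring.
transitivity (sy ^ ((2 * K)%N%:Z + (N%:Z + N%:Z))
              * z ^ ((2 * K)%N%:Z + N%:Z - b%:Z)); last first.
  by rewrite !exprzDr //; ring.
by rewrite /a /b' /c; congr (_ ^ _ * _ ^ _); lia.
Qed.

End StateSum.
End PartialDual.

(** * Strands of a diagram; diagrams without crossings *)

Lemma out_step (S : surface) (D : diagram S) (d : S) :
  out D (step D d) = out D d.
Proof.
rewrite /step; case Dd: (out D d) => //.
by rewrite out_turn ?(out_flip Dd) // /is_on flipK Dd orbT.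
Qed.

Lemma out_fconnect (S : surface) (D : diagram S) (d e : S) :
  fconnect (step D) d e -> out D e = out D d.
Proof.
by move/iter_findex <-; elim: (findex _ _ _) => //= n <-; apply: out_step.
Qed.

(** Since [step] preserves [out] and is the identity off the outgoing darts, only these matter, and
    there it composes [flip] with [turn], both involutive on strands. Injectivity makes [fconnect]
    symmetric. *)
Lemma step_inj (S : surface) (D : diagram S) : injective (step D).
Proof.
have flip_on d : out D d -> is_on (out D) (flip d).
  by move=> Dd; rewrite /is_on flipK Dd orbT.
move=> d d' E; have := congr1 (out D) E; rewrite !out_step => Ed.
move: E; rewrite /step -Ed; case: ifP => // Dd.
have Dd' : out D d' by rewrite -Ed.
move/(congr1 (turn D)); rewrite !turnK ?flip_on // => /(congr1 (@flip S)).
by rewrite !flipK.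
Qed.

Section CrossingFree.
Variables (S : surface) (D : diagram S).
Hypothesis no_crossing : forall d, ~~ crossing D d.

Lemma crossing_free_disjoint : disjoint_projections D.
Proof. by move=> d e; rewrite (negbTE (no_crossing d)). Qed.

Lemma crossing_free_descending : descending_diagram D.
Proof.
have sI := @step_inj S D.
(* One base point for each component of the link, the root of its orbit; the condition on crossings
   is vacuous. *)
exists [seq d <- enum S | out D d && (froot (step D) d == d)].
set bs := [seq _ <- _ | _]; split; first 1 last.
- move=> d; apply/flatten_mapP/idP => [[b] | Dd].
    rewrite mem_filter inE => /andP[/andP[Db _] _].
    by rewrite -fconnect_orbit => /out_fconnect ->.
  have rd := connect_root (frel (step D)) d.
  exists (froot (step D) d); last by rewrite -fconnect_orbit fconnect_sym.
  rewrite mem_filter mem_enum andbT (root_root (fconnect_sym sI)) eqxx andbT.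
  by rewrite (out_fconnect rd).
- by move=> d e; rewrite (negbTE (no_crossing d)).
(* Distinct base points are distinct roots, so their orbits are disjoint. *)
have: uniq bs by rewrite filter_uniq ?enum_uniq.
have: all (fun d => froot (step D) d == d) bs.
  by apply/allP => d; rewrite mem_filter => /andP[/andP[]].
elim: bs => //= b bs IHbs /andP[/eqP rb rbs] /andP[bbs ubs].
rewrite cat_uniq orbit_uniq IHbs // andbT.
apply/hasPn => d /flatten_mapP[c cbs]; rewrite -!fconnect_orbit => cd.
apply: contra bbs => bd; suff -> : b = c by [].
rewrite -rb -(eqP (allP rbs _ cbs)).
apply/eqP; rewrite (root_connect (fconnect_sym sI)).
by apply: connect_trans bd _; rewrite fconnect_sym.
Qed.

End CrossingFree.

(* The stages of the skein resolution of the clasp of a ribbon: [Switched] after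
   the change of one crossing, [Kinked] after its smoothing; then [Unlinked] and
   [Smoothed] after the second and the first Reidemeister move. *)
Inductive stage := Clasped | Switched | Kinked | Unlinked | Smoothed.

(** * The diagrams obtained by resolving clasps *)

Section Resolution.
Variables (G : ribbon_graph) (o : orientation G).
Implicit Types (st : edge G -> stage) (p q : point (edge G)).

Local Notation S := (link_surface o).

(* Tells the two crossings of a ribbon apart. *)
Definition main_end p : bool := p.1.2 (+) (sign (label p) && p.2).

Lemma main_end_crossing p : main_end (crossing_end p) = main_end p.
Proof.
rewrite /main_end crossing_end_label /crossing_end.
case: (sign (label p)) => /=.
  by rewrite addNb addbN negbK.
by rewrite !addbF.
Qed.

Lemma main_end_strand p : main_end (strand_end p) = ~~ main_end p.
Proof.
rewrite /main_end strand_end_label /strand_end.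
case: (sign (label p)) => /=.
  by rewrite addbN.
by rewrite !addbF.
Qed.

(** The four points of a ribbon form two pairs, one for each crossing of the clasp; [main_end]
    separates the pairs and [crossing_end] exchanges the points of a pair. *)
Lemma same_crossing_end p q :
  (label q == label p) && (main_end q == main_end p) =
  (q == p) || (q == crossing_end p).
Proof.
case: p q => [[e i] t] [[f j] u]; rewrite /main_end /crossing_end /label /=.
case: eqVneq => [->|nfe] /=; last first.
  by rewrite !xpair_eqE (negbTE nfe) /=; case: ifP => _;
     rewrite /side /other_end !xpair_eqE /= (negbTE nfe).
by case: ifP => _; rewrite !xpair_eqE eqxx /=; case: i t j u => [] [] [] [].
Qed.

Lemma crossing_end_neq p : crossing_end p != p.
Proof.
apply/eqP => E; have := enter_crossing_end o p.
by rewrite E; case: enter.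
Qed.

Lemma strand_crossing_end p :
  strand_end (crossing_end p) = crossing_end (strand_end p).
Proof.
case: p => -[e i] t; rewrite /strand_end /crossing_end /label /=.
by case s: (sign e); rewrite /= s.
Qed.

Lemma same_vertex_ribbon p b q c :
  same_vertex (inl (p, b) : S) (inl (q, c)) =
  (label q == label p) && (main_end q == main_end p).
Proof.
rewrite /same_vertex; apply/idP/idP => [/iter_findex E | ].
  have: match iter (findex (@rot S) (inl (p, b)) (inl (q, c)))
                   (@rot S) (inl (p, b)) with
        | inl (r, _) => (label r == label p) && (main_end r == main_end p)
        | inr _ => false end.
    elim: (findex _ _ _) => /= [|n]; first by rewrite !eqxx.
    case: (iter _ _ _) => [[r d]|//] /=.
    by rewrite crossing_end_label main_end_crossing.
  by rewrite E.
rewrite same_crossing_end => /orP[] /eqP ->.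
  have [-> | nbc] := eqVneq c b; first exact: connect0.
  have -> : c = ~~ b by case: b c nbc => [] [].
  by rewrite -(link_rot2 o); exact: (fconnect_iter (@rot S) 2).
pose d := b (+) (enter o p (+) sign (label p)).
have [-> | ncd] := eqVneq c d; first exact: (fconnect1 (@rot S)).
have -> : c = ~~ d by case: d c ncd => [] [].
by rewrite -(link_rot2 o); exact: (fconnect_iter (@rot S) 3).
Qed.

Lemma same_vertex_circle p b x : same_vertex (inl (p, b) : S) (inr x) = false.
Proof.
apply/negP => /iter_findex E.
have: if iter (findex (@rot S) (inl (p, b)) (inr x)) (@rot S) (inl (p, b))
      is inl _ then true else false.
  by elim: (findex _ _ _) => //= n; case: (iter _ _ _) => [[]|].
by rewrite E.
Qed.

Section Stage.
Variable st : edge G -> stage.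

(* The four darts (p, false) of a ribbon bound the bigon of its clasp.  The move
   to [Unlinked] exchanges the two sides of the bigon, hence reverses the strands
   along it; the move to [Smoothed] erases them. *)

Definition res_out (d : S) : bool :=
  match d with
  | inl (p, b) =>
    match st (label p) with
    | Unlinked => ~~ enter o p
    | Smoothed => b && ~~ enter o p
    | _ => b (+) enter o p
    end
  | inr (_, b) => b
  end.

(** The neighbours of [(p, b)] at its crossing are the two darts of [crossing_end p]. Joining it to
    the one with the same [b] is the smoothing that respects the orientation of the clasp; joining
    it to the other one is the opposite smoothing, left by the second Reidemeister move. *)
Definition res_turn (d : S) : S :=
  match d with
  | inl (p, b) =>
    match st (label p) with
    | Unlinked => inl (crossing_end p, ~~ b)
    | Smoothed => inl (crossing_end p, b)
    | Kinked => if main_end p then inl (crossing_end p, b) else inl (p, ~~ b)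
    | _ => inl (p, ~~ b)
    end
  | inr (i, b) => inr (i, ~~ b)
  end.

Definition res_over (d : S) : bool :=
  match d with
  | inl (p, _) =>
    (enter o p (+) sign (label p)) (+)
    (if st (label p) is Switched then main_end p else false)
  | inr _ => false
  end.

Lemma res_out_flip d : res_out d -> ~~ res_out (flip d).
Proof.
case: d => [[p []]|[i b]] /=; last by rewrite negbK.
  by rewrite enter_arc; case: (st _); case: (st _); case: (enter o p).
by rewrite strand_end_label enter_strand_end; case: (st _); case: (enter o p).
Qed.

Definition res_on_dart (d : S) : bool :=
  match d with
  | inl (p, b) => b || (if st (label p) is Smoothed then false else true)
  | inr _ => true
  end.

Lemma res_on d : is_on res_out d = res_on_dart d.
Proof.
rewrite /is_on; case: d => [[p []]|[i b]] /=; last by rewrite orbN.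
  by rewrite enter_arc; case: (st _); case: (st _); case: (enter o p).
by rewrite strand_end_label enter_strand_end; case: (st _); case: (enter o p).
Qed.

Lemma res_turn_vertex d : is_on res_out d -> same_vertex d (res_turn d).
Proof.
move=> _; case: d => [[p b]|[i b]].
  2: exact: (link_turn_vertex (inr (i, b) : S)).
by rewrite /=; case: (st _); try case: ifP => _;
   rewrite same_vertex_ribbon ?crossing_end_label ?main_end_crossing !eqxx.
Qed.

Lemma res_turn_on d : is_on res_out d -> is_on res_out (res_turn d).
Proof.
rewrite !res_on; case: d => [[p b]|[i b]] //=.
case E: (st _); try case: ifP => _;
  by rewrite /= ?crossing_end_label ?E ?orbT ?orbF.
Qed.

Lemma res_turnK d : is_on res_out d -> res_turn (res_turn d) = d.
Proof.
move=> _; case: d => [[p b]|[i b]] /=; last by rewrite negbK.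
case E: (st _) => /=; try case M: (main_end p) => /=;
  by rewrite ?main_end_crossing ?crossing_end_label ?E ?M ?crossing_endK ?negbK.
Qed.

Lemma res_out_turn d : is_on res_out d -> res_out (res_turn d) = ~~ res_out d.
Proof.
rewrite res_on; case: d => [[p b]|[i b]] //=.
case E: (st _); try case: (main_end p); rewrite /= ?crossing_end_label ?E;
  by rewrite ?enter_crossing_end; case: b (enter o p) => [] [].
Qed.

Lemma res_vertex_strands (d e : S) :
  is_on res_out d -> is_on res_out e -> same_vertex d e ->
  [|| e == d, e == res_turn d | order (@rot S) d == 4]%N.
Proof.
move=> _ _; case: d => [[p b]|[i b]] de; first by rewrite link_order !orbT.
exact: (link_vertex_strands (link_on _) (link_on _) de).
Qed.

Lemma res_crossing (d : S) :
  is_crossing res_out res_turn d =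
  if d is inl (p, b) then
    match st (label p) with
    | Unlinked | Smoothed => false
    | Kinked => ~~ main_end p
    | _ => true
    end
  else false.
Proof.
rewrite /is_crossing !res_on; case: d => [[p b]|[i b]]; last first.
  by rewrite /= negbK; apply/eqP => -[]; case: b.
rewrite [rot (rot _)]link_rot2 /= crossing_end_label.
by case: (st _); rewrite ?orbT /=; try case: (main_end p);
  rewrite /= ?eqxx // ?andbF //;
  rewrite /eq_op /= /eq_op /= (negbTE (crossing_end_neq p)) ?andbF.
Qed.

Lemma res_over_turn d :
  is_crossing res_out res_turn d -> res_over (res_turn d) = res_over d.
Proof.
rewrite res_crossing; case: d => [[p b]|[i b]] //=.
by case E: (st _) => //=; rewrite ?E // => /negbTE -> /=; rewrite E.
Qed.

Lemma res_over_rot d :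
  is_crossing res_out res_turn d -> res_over (rot d) = ~~ res_over d.
Proof.
rewrite res_crossing; case: d => [[p b]|[i b]] //= _.
by rewrite crossing_end_label enter_crossing_end main_end_crossing !addNb.
Qed.

Definition resolution : diagram S :=
  @Diagram S res_out res_turn res_over res_out_flip res_turn_vertex res_turn_on
    res_turnK res_out_turn res_vertex_strands res_over_turn res_over_rot.

End Stage.

(** The diagrams agree dart by dart without being equal as records, so the identity is used as a
    homeomorphism. *)
Lemma resolution_link st : (forall e, st e = Clasped) ->
  isotopic (resolution st) (link_diagram o).
Proof.
move=> stC; apply: IsoHomeo; exists id; split; split=> //.
- by exists id.
- by case=> [[p b]|[i b]] //=; rewrite stC.
- by case=> [[p b]|[i b]] //= _; rewrite stC.
- by case=> [[p b]|[i b]] //= _; rewrite stC addbF.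
Qed.

Lemma resolution_ext st st' : st =1 st' ->
  isotopic (resolution st) (resolution st').
Proof.
move=> stE; apply: IsoHomeo; exists id; split; split=> //.
- by exists id.
- by case=> [[p b]|[i b]] //=; rewrite stE.
- by case=> [[p b]|[i b]] //= _; rewrite stE.
- by case=> [[p b]|[i b]] //= _; rewrite stE.
Qed.

(** * The skein relation and the Reidemeister moves at one ribbon *)

Section Moves.
Variables (e : edge G) (st st' st0 : edge G -> stage).
Hypotheses (st'E : forall f, f != e -> st' f = st f)
           (st0E : forall f, f != e -> st0 f = st f).

Lemma main_end_exists b c :
  exists p, [/\ label p = e, main_end p = b & enter o p = c].
Proof.
have [p [pe pb]] : exists p, label p = e /\ main_end p = b.
  by exists (e, b, false); split=> //; rewrite /main_end andbF addbF.
have [<- | nc] := eqVneq (enter o p) c; first by exists p.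
exists (crossing_end p); rewrite crossing_end_label main_end_crossing.
by split=> //; rewrite enter_crossing_end; case: (enter o p) c nc => [] [].
Qed.

Lemma resolution_skein :
  st e = Clasped -> st' e = Switched -> st0 e = Kinked ->
  exists d, skein_triple (resolution st) (resolution st') (resolution st0) d.
Proof.
move=> stC stS stK.
(* The relation is applied at the main crossing. The dart sought is on the upper strand, which
   forces [enter o p = ~~ sign e]; being outgoing, it then has [sign e] as second component. *)
have [p [pe pm po]] := main_end_exists true (~~ sign e).
have pc : label (crossing_end p) = e by rewrite crossing_end_label.
have poc : enter o (crossing_end p) = sign e.
  by rewrite enter_crossing_end po negbK.
exists (inl (p, sign e)); split; [|split].
- split=> /=; rewrite /crossing ?res_crossing /= ?pc ?pe ?stC //=.
  + by rewrite po; case: (sign e).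
  + by rewrite poc po; case: (sign e).
  + by rewrite po; case: (sign e).
- split=> [d|d _|d _]; case: d => [[q b]|[i b]] //=.
  + by have [->|/st'E ->] := eqVneq (label q) e; rewrite ?stC ?stS.
  + by have [->|/st'E ->] := eqVneq (label q) e; rewrite ?stC ?stS.
  + rewrite same_vertex_ribbon pe pm.
    have [->|/[dup] /st'E -> /negbTE _] := eqVneq (label q) e.
      by rewrite stC stS addbF eqb_id.
    by rewrite addbF.
  + by rewrite same_vertex_circle.
- split=> /=.
  + case=> [[q b]|[i b]] //=.
    by have [->|/st0E ->] := eqVneq (label q) e; rewrite ?stC ?stK.
  + by rewrite pc pe stK stC pm po; case: (sign e).
  + rewrite pc pe stK stC main_end_crossing pm crossing_endK po.
    by case: (sign e).
  + case=> [[q b]|[i b]]; rewrite /agree_at //=.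
    rewrite same_vertex_ribbon pe pm.
    have [->|/st0E ->] //= := eqVneq (label q) e.
    by rewrite stC stK eqb_id => /negbTE ->.
Qed.

(** Among the four inner darts of the clasp, the condition [enter o q = sign e] selects the two that
    have the bigon on their left. *)
Lemma same_face_bigon q d : label q = e -> enter o q = sign e ->
  same_face (inl (q, false) : S) d =
  (d == inl (q, false)) || (d == inl (strand_end (crossing_end q), false)).
Proof.
move=> qe qs; pose q' := strand_end (crossing_end q).
have q'e : label q' = e by rewrite strand_end_label crossing_end_label.
have q's : enter o q' = sign e.
  by rewrite enter_strand_end enter_crossing_end negbK.
pose face := fun x : S => flip (rot x).
have face_q r : label r = e -> enter o r = sign e ->
    face (inl (r, false)) = inl (strand_end (crossing_end r), false).
  by move=> re rs; rewrite /face /= re rs addbb.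
have q'q : strand_end (crossing_end q') = q.
  by rewrite /q' -strand_crossing_end strand_endK crossing_endK.
rewrite /same_face; apply/idP/orP => [/iter_findex <- | [] /eqP ->].
- elim: (findex _ _ _) => [|n IHn]; first by left.
  rewrite iterS; case: IHn => /eqP ->; [right | left]; apply/eqP.
    exact: face_q.
  by rewrite [LHS](face_q q') ?q'q.
- exact: connect0.
- by rewrite -face_q //; apply: fconnect1.
Qed.

Lemma on_bigon_boundary q d : label q = e -> enter o q = sign e ->
  on_face_boundary (inl (q, false) : S) d =
  if d is inl (r, b) then (label r == e) && ~~ b else false.
Proof.
move=> qe qs; rewrite /on_face_boundary !same_face_bigon //.
case: d => [[r b]|[i b]] //=.
have inlE (x y : point (edge G)) c c' :
  (inl (x, c) == inl (y, c') :> S) = (x == y) && (c == c') by [].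
rewrite !inlE; case: b; first by rewrite !andbF.
rewrite !andbT !(inv_eq (@strand_endK G)) strand_endK strand_crossing_end.
pose same p := (label r == label p) && (main_end r == main_end p).
(* The four inner darts are regrouped by crossing: [q] and [strand_end q] lie at different crossings
   of the ribbon. *)
transitivity (same q || same (strand_end q)).
  rewrite /same !same_crossing_end -strand_crossing_end.
  by move: (r == _) (r == _) (r == _) (r == _) => [] [] [] [].
rewrite /same strand_end_label main_end_strand qe.
by case: (_ == e) => //=; case: (main_end r); case: (main_end q).
Qed.

Lemma resolution_unlink :
  st e = Switched -> st' e = Unlinked ->
  reidemeister2 (resolution st) (resolution st').
Proof.
move=> stS stU.
have [q [qe qm qs]] := main_end_exists true (sign e).
pose q' := strand_end (crossing_end q).
have q'e : label q' = e by rewrite strand_end_label crossing_end_label.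
have q's : enter o q' = sign e.
  by rewrite enter_strand_end enter_crossing_end negbK.
have q'm : main_end q' = false.
  by rewrite main_end_strand main_end_crossing qm.
exists (inl (q, false)), (inl (q', false)); split; [|split].
- split.
  + by rewrite /= qe qs; case: (sign e).
  + by rewrite same_face_bigon // eqxx orbT.
  + by rewrite same_vertex_ribbon qm q'm andbF.
  + move=> d; rewrite same_face_bigon // !inE.
    by move=> /orP[] /eqP ->; rewrite eqxx ?orbT.
(* In the clasp each strand is above at one crossing; switching the main crossing puts the same
   strand above at both. *)
- split; rewrite /crossing ?res_crossing /= ?qe ?q'e ?stS //.
  rewrite !crossing_end_label main_end_crossing q'e stS enter_crossing_end.
  by rewrite qs q's qm q'm; case: (sign e).
split.
- move=> d; rewrite /on !res_on; case: d => [[r b]|[i b]] //=.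
  by have [->|/st'E ->] := eqVneq (label r) e; rewrite ?stS ?stU.
- move=> d; rewrite (on_bigon_boundary _ qe qs); case: d => [[r b]|[i b]] //=.
  have [->|/st'E ->] //= := eqVneq (label r) e.
  by rewrite stS stU negbK => ->.
- by rewrite /= qe qs addbb !crossing_end_label qe stS stU crossing_endK.
- by rewrite /= q'e q's addbb !crossing_end_label q'e stS stU crossing_endK.
- case=> [[r b]|[i b]]; rewrite /agree_at //=.
  rewrite !same_vertex_ribbon qe q'e qm q'm /crossing res_crossing /=.
  have [->|/st'E ->] //= := eqVneq (label r) e.
  by case: (main_end r).
Qed.

(** Smoothing the main crossing turns the boundary of the bigon into a loop based at the other
    crossing, which the first Reidemeister move removes. *)
Lemma resolution_unkink :
  st e = Kinked -> st' e = Smoothed ->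
  reidemeister1 (resolution st) (resolution st').
Proof.
move=> stK stO.
have [q [qe qm qs]] := main_end_exists false (sign e).
pose q' := strand_end (crossing_end q).
have q'e : label q' = e by rewrite strand_end_label crossing_end_label.
have q's : enter o q' = sign e.
  by rewrite enter_strand_end enter_crossing_end negbK.
have q'm : main_end q' = true.
  by rewrite main_end_strand main_end_crossing qm.
exists (inl (q, false)); split; split.
- by rewrite /= qe qs; case: (sign e).
- by rewrite /crossing res_crossing qe stK qm.
- move=> d; rewrite same_face_bigon // !inE => /orP[] /eqP -> => [|_].
    by rewrite eqxx.
  rewrite /on res_on /= -/q' q'e stK q's addbb /= crossing_end_label q'e stK.
  by rewrite main_end_crossing q'm crossing_endK eqxx.
- move=> d; rewrite (on_bigon_boundary _ qe qs); case: d => [[r b]|[i b]] //=.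
    have [->|/st'E ->] //= := eqVneq (label r) e; last by rewrite andbT.
    by rewrite stK stO negbK; case: b; rewrite ?andbF ?andbT.
  by rewrite andbT.
- rewrite /= qe qs addbb stK qm /= crossing_end_label qe stK stO.
  by rewrite main_end_crossing qm.
- move=> d; rewrite (on_bigon_boundary _ qe qs); case: d => [[r b]|[i b]] //=.
  rewrite same_vertex_ribbon qe qm /agree_at /crossing res_crossing /=.
  have [->|/st'E ->] //= := eqVneq (label r) e.
  by rewrite stK stO negbK => ->; case: (main_end r).
Qed.

End Moves.
End Resolution.

(** * State diagrams and boundary components of spanning subgraphs *)

Section StateDiagrams.
Variables (G : ribbon_graph) (o : orientation G).
Implicit Types (F B : {set edge G}) (p q : point (edge G)).

Local Notation S := (link_surface o).

(** [B] is the set of ribbons still to be resolved. The others are resolved so that the strands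
    follow the boundary of (V(G), F). *)
Definition state_stage B F (e : edge G) : stage :=
  if e \in B then Clasped
  else if (e \in F) == sign e then Smoothed else Unlinked.

Definition state_diagram B F : diagram S := resolution o (state_stage B F).

Lemma enter_across F p : enter o (across F p) = ~~ enter o p.
Proof. by rewrite /across; case: ifP; rewrite ?enter_side ?enter_other_end. Qed.

Section Count.
Variable F : {set edge G}.
Local Notation D := (state_diagram set0 F).
Local Notation bdry :=
  [rel p q : point (edge G) | (q == arc p) || (q == across F p)].

(** A smoothed clasp connects the two ends at each crossing, an unlinked one the two ends of each
    former strand; this matches the boundary of (V(G), F) in all four cases. *)
Lemma acrossE p :
  across F p = if (label p \in F) == sign (label p) then crossing_end p
               else strand_end p.
Proof.
by rewrite /across /crossing_end /strand_end; case: (_ \in F); case: (sign _).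
Qed.

Lemma state_free (d : S) : ~~ crossing D d.
Proof.
rewrite /crossing res_crossing; case: d => [[p b]|//].
by rewrite /state_stage in_set0; case: ifP.
Qed.

Lemma step_arc p : enter o p ->
  step D (inl (arc p, true)) = turn D (inl (p, true)).
Proof.
move=> po; have a_out : out D (inl (arc p, true)).
  by rewrite /= enter_arc po; case: (state_stage _ _ _).
by rewrite /step a_out /= arcK.
Qed.

(** One step crosses a smoothed clasp; an unlinked one takes two, passing along the bigon. *)
Lemma step_connect_across p : enter o p ->
  fconnect (step D) (inl (arc p, true)) (inl (across F p, true)).
Proof.
move=> po; have s1 := step_arc po; rewrite acrossE.
case E: ((label p \in F) == sign (label p)).
  have <- : step D (inl (arc p, true)) = inl (crossing_end p, true).
    by rewrite s1 /= /state_stage in_set0 E.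
  exact: fconnect1.
apply: connect_trans (fconnect1 _ _) _.
rewrite s1 /= {1}/state_stage in_set0 E.
have <- : step D (inl (crossing_end p, false)) = inl (strand_end p, true).
  rewrite /step /= crossing_end_label enter_crossing_end po strand_end_label.
  rewrite crossing_end_label /state_stage in_set0 E /=.
  by rewrite -strand_crossing_end crossing_endK.
exact: fconnect1.
Qed.

(** On the ribbons, an adjunction matches orbits of [step] with boundary components; on the isolated
    circles, each outgoing dart is fixed by [step]. *)
Lemma nlink_state : nlink D = nboundaries F.
Proof.
have sI := @step_inj S D.
have sC := fconnect_sym sI.
pose ribbon := [pred d : S | if d is inl _ then true else false].
have ribbon_step d : (step D d \in ribbon) = (d \in ribbon).
  rewrite !inE /step; case: ifP => // _; case: d => [[p []]|[i b]] //=;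
  by case: (state_stage _ _ _) => //; case: ifP.
rewrite /nlink /n_comp_mem -(cardID ribbon); congr (_ + _)%N.
  pose a := [predI [pred d | out D d] & ribbon].
  transitivity (n_comp (frel (step D)) a).
    by apply: eq_card => d; rewrite !inE andbA.
  have cl_a : closed (frel (step D)) a.
    by move=> d _ /eqP <-; have := ribbon_step d; rewrite !inE out_step => ->.
  (* The strand through the arc at p; the darts (p, false) are only met in the
     middle of an unlinked clasp. *)
  pose h p : S := inl (if enter o p then arc p else p, true).
  have ha p : h p \in a.
    rewrite !inE /=; case E: (enter o p); rewrite ?enter_arc E;
    by case: (state_stage _ _ _).
  rewrite (adjunction_n_comp h sC (sym_connect_sym (boundary_sym F)) cl_a).
    by apply: eq_n_comp_r => p; apply: ha.
  have notin x : inr x \in a -> False by rewrite !inE andbF.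
  (* Back from outgoing ribbon darts to points: a dart inside an unlinked clasp is sent to the point
     where its strand entered the clasp. The dependent match discards the circles. *)
  pose f (d : S) : d \in a -> point (edge G) :=
    match d return d \in a -> point (edge G) with
    | inl (p, b) => fun _ => if b then p else crossing_end p
    | inr x => fun x_a => False_rect _ (notin x x_a)
    end.
  have out_a d : d \in a -> out D d by case/andP.
  have out_enter p b : inl (p, b) \in a -> ~~ enter o p.
    rewrite !inE andbT /= /state_stage in_set0; case: ifP => _ //.
    by case/andP.
  have out_false p : inl (p, false) \in a ->
      state_stage set0 F (label p) = Unlinked.
    by rewrite !inE andbT /= /state_stage in_set0; case: ifP.
  have bdry_across p : connect bdry p (across F p).
    by apply: connect1; rewrite /= eqxx orbT.
  have bdry_arc p : connect bdry p (arc p).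
    by apply: connect1; rewrite /= eqxx.
  apply: (intro_adjunction (sym_connect_sym (boundary_sym F)) cl_a f)
    => [d da | p pa].
    split.
      case: d da => [[p [] pa]|x xa]; last by case: (notin _ xa).
        by rewrite /h (negbTE (out_enter _ _ pa)).
      rewrite /h enter_crossing_end (out_enter _ _ pa) sC.
      have E : step D (inl (arc (crossing_end p), true)) = inl (p, false).
        rewrite step_arc ?enter_crossing_end ?(out_enter _ _ pa) //=.
        by rewrite crossing_end_label (out_false _ pa) crossing_endK.
      have := fconnect1 (step D) (inl (arc (crossing_end p), true)).
      by rewrite E.
    move=> d' d'a /eqP dd'; case: d da dd' => [[p [] pa]|x xa].
    3: by case: (notin _ xa).
      have : step D (inl (p, true)) = turn D (inl (arc p, true)).
        by rewrite /step (out_a _ pa).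
      move=> -> /= dd'; case: d' / dd' d'a.
      rewrite /state_stage in_set0; case E: (_ == _) => d'a /=.
        apply: connect_trans (bdry_arc p) _.
        by have := bdry_across (arc p); rewrite acrossE E.
      by rewrite crossing_endK.
    have : step D (inl (p, false)) = turn D (inl (strand_end p, false)).
      by rewrite /step (out_a _ pa).
    move=> -> /= dd'; case: d' / dd' d'a.
    rewrite strand_end_label (out_false _ pa) => d'a /=.
    have := bdry_across (crossing_end p); rewrite acrossE crossing_end_label.
    have := out_false _ pa; rewrite /state_stage in_set0.
    by case: (_ == _) => // _; rewrite strand_crossing_end.
  split; first by rewrite /=; case: ifP => _; rewrite ?connect0.
  move=> q /orP[] /eqP ->.
    rewrite /h enter_arc arcK; case: (enter o p) => /=; exact: connect0.
  rewrite /h enter_across; case E: (enter o p) => /=.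
    exact: step_connect_across.
  (* Here the strand leaves the ribbon at [p], so it is followed from [across F p]. *)
  rewrite sC -{2}(acrossK F p); apply: step_connect_across.
  by rewrite enter_across E.
pose circle (i : 'I_(isolated G)) : S := inr (i, true).
have circle_inj : injective circle by move=> i j [].
rewrite -[RHS]card_ord -(card_image circle_inj); apply: eq_card => d.
rewrite !inE; apply/andP/imageP => [[] | [i _ ->]].
  by case: d => [//|[i []]] _ /andP[] // _ _; exists i.
split=> //; rewrite andbT; apply/eqP.
have /iter_findex <- := connect_root (frel (step D)) (circle i).
exact: iter_fix.
Qed.

End Count.
End StateDiagrams.

(** * Expansion of the homfly polynomial *)

Lemma XX_neq0 : XX != 0.
Proof. by rewrite /XX tofrac_eq0 polyC_eq0 polyX_eq0. Qed.

Section Homfly.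
Variable P : forall S : surface, diagram S -> fracXY.
Hypothesis hP : is_homfly P.

Section Expansion.
Variables (G : ribbon_graph) (o : orientation G).
Implicit Types (F B : {set edge G}).

Definition stage_weight F (e : edge G) : fracXY :=
  if (e \in F) == sign e then XX^-1 * YY else XX^-1 ^+ 2.

(** Of the two subgraphs, exactly one has [e] counted by N, and it gives the smoothed clasp; which
    one depends on the sign of [e]. *)
Lemma homfly_resolve_one (e : edge G) B F :
  e \notin B ->
  P (state_diagram o (e |: B) F) =
  stage_weight (e |: F) e * P (state_diagram o B (e |: F)) +
  stage_weight (F :\ e) e * P (state_diagram o B (F :\ e)).
Proof.
move=> eB.
have st_off c f : f != e ->
    state_stage (e |: B) F f = state_stage B (if c then e |: F else F :\ e) f.
  by move=> fe; rewrite /state_stage; case: c; rewrite !inE (negbTE fe).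
pose st c f := if f == e then c else state_stage (e |: B) F f.
have st_e c : st c e = c by rewrite /st eqxx.
have st_ne c f : f != e -> st c f = state_stage (e |: B) F f.
  by rewrite /st => /negbTE ->.
have st_st c c' f : f != e -> st c f = st c' f by move=> fe; rewrite !st_ne.
have stC : state_stage (e |: B) F =1 st Clasped.
  by move=> f; rewrite /st; case: eqP => // ->; rewrite /state_stage !inE eqxx.
have stF (c : bool) :
    state_stage B (if c then e |: F else F :\ e) =1
    st (if c == sign e then Smoothed else Unlinked).
  move=> f; rewrite /st; case: eqVneq => [->|fe]; last by rewrite -st_off.
  by rewrite /state_stage (negbTE eB); case: c; rewrite !inE eqxx.
pose Q c := P (resolution o (st c)).
(* The skein relation solved for the positive crossing, with the negative and the smoothed diagrams
   simplified by Reidemeister moves. *)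
have skein : Q Clasped = XX^-1 ^+ 2 * Q Unlinked + XX^-1 * YY * Q Smoothed.
  have [d] := resolution_skein o (st_st Switched Clasped) (st_st Kinked Clasped)
    (st_e Clasped) (st_e Switched) (st_e Kinked).
  move/(homfly_skein hP).
  have /IsoR2/(homfly_isotopic hP) -> :=
    resolution_unlink o (st_st Unlinked Switched) (st_e _) (st_e _).
  have /IsoR1/(homfly_isotopic hP) -> :=
    resolution_unkink o (st_st Smoothed Kinked) (st_e _) (st_e _).
  rewrite -/(Q _) -/(Q Unlinked) -/(Q Smoothed) => sk.
  apply: (mulfI XX_neq0); rewrite -[LHS](subrK (XX^-1 * Q Unlinked)) sk.
  by rewrite mulrDr expr2 !mulrA mulfV ?XX_neq0 // !mul1r addrC.
have PF (c : bool) : P (state_diagram o B (if c then e |: F else F :\ e)) =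
    Q (if c == sign e then Smoothed else Unlinked).
  by rewrite (homfly_isotopic hP (resolution_ext o (stF c))).
rewrite (homfly_isotopic hP (resolution_ext o stC)) -/(Q _) skein.
rewrite (PF true) (PF false) /stage_weight !inE eqxx /=.
by case: (sign e); rewrite // addrC.
Qed.

(** Induction on the size of [B], one clasp at a time. The sum runs over the subgraphs that agree
    with [F] outside [B], where alone [state_stage B F] depends on [F]. *)
Lemma homfly_expand B F :
  P (state_diagram o B F) =
  \sum_(F' : {set edge G} | F' :\: B == F :\: B)
     (\prod_(e in B) stage_weight F' e) * P (state_diagram o set0 F').
Proof.
have [n] := ubnP #|B|; elim: n B F => // n IHn B F.
have [-> _ | [e eB]] := set_0Vmem B.
  rewrite (big_pred1 F); last by move=> F'; rewrite !setD0.
  by rewrite big_set0 mul1r.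
rewrite -(setD1K eB) cardsU1 !inE eqxx add1n ltnS.
move: (B :\ e) (setD11 e B) => {eB}B /negbT eB leBn.
(* Each term of the one-clasp resolution is the part of the sum where the membership of [e] is
   prescribed by [c]. *)
have sumE (c : bool) :
    stage_weight (if c then e |: F else F :\ e) e *
      P (state_diagram o B (if c then e |: F else F :\ e)) =
    \sum_(F' : {set edge G} |
          (F' :\: (e |: B) == F :\: (e |: B)) && ((e \in F') == c))
      (\prod_(f in e |: B) stage_weight F' f) * P (state_diagram o set0 F').
  rewrite IHn // mulr_sumr; apply: eq_big => [F' | F' /eqP/setP/(_ e)].
    apply/eqP/andP => [/setP F'E | [/eqP/setP F'E /eqP ec]].
      split; last by have := F'E e; rewrite !inE eB; case: c {F'E} => /=;
        rewrite !inE eqxx => ->.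
      apply/eqP/setP => f; have := F'E f; rewrite !inE negb_or.
      by case: c {F'E}; rewrite !inE; case: eqP.
    apply/setP => f; have := F'E f; rewrite !inE negb_or.
    have [-> _ | nfe] := eqVneq f e.
      by rewrite ec; case: c {ec}; rewrite !inE eqxx.
    by case: c {ec}; rewrite !inE (negbTE nfe).
  rewrite !inE eB /= => ec; rewrite mulrA big_setU1 //=; congr (_ * _ * _).
  by rewrite /stage_weight ec.
rewrite homfly_resolve_one // (sumE true) (sumE false).
rewrite [RHS](bigID (fun F' => e \in F')) /=.
by congr (_ + _); apply: eq_bigl => F'; case: (e \in F').
Qed.

Lemma homfly_link :
  P (link_diagram o) =
  \sum_(F : {set edge G})
     (\prod_e stage_weight F e) * P (state_diagram o set0 F).
Proof.
have stC (e : edge G) : state_stage setT set0 e = Clasped.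
  by rewrite /state_stage in_setT.
rewrite -(homfly_isotopic hP (resolution_link o stC)) -/(state_diagram _ _ _).
rewrite homfly_expand; apply: eq_big => [F | F _].
  by rewrite !setDT eqxx.
by congr (_ * _); apply: eq_bigl => e; rewrite in_setT.
Qed.

Lemma prod_stage_weight F :
  \prod_e stage_weight F e =
  (XX^-1 * YY) ^+ nagree F * (XX^-1 ^+ 2) ^+ (#|edge G| - nagree F).
Proof.
rewrite (bigID (fun e => (e \in F) == sign e)) /=; congr (_ * _).
  rewrite (eq_bigr (fun=> XX^-1 * YY)) => [|e].
  2: by rewrite /stage_weight => ->.
  by rewrite prodr_const; congr (_ ^+ _); apply: eq_card => e; rewrite !inE.
rewrite (eq_bigr (fun=> XX^-1 ^+ 2)) => [|e /negbTE].
2: by rewrite /stage_weight => ->.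
rewrite prodr_const; congr (_ ^+ _); apply/esym.
rewrite -(cardC [pred e | (e \in F) == sign e]) /nagree cardsE addKn.
by apply: eq_card => e; rewrite !inE.
Qed.

(** The dart [d] ensures that the link is nonempty, so that the predecessor is a true subtraction
    and the axiom on descending links applies. *)
Lemma homfly_state F (d : link_surface o) :
  P (state_diagram o set0 F) = ((XX - XX^-1) / YY) ^+ (nboundaries F).-1.
Proof.
apply: (homfly_descending hP).
- exact/crossing_free_descending/state_free.
- exact/crossing_free_disjoint/state_free.
rewrite prednK ?nlink_state // -(nlink_state o).
have [d' d'o] : exists d', out (state_diagram o set0 F) d'.
  case: d => [[p _]|[i _]]; last by exists (inr (i, true)).
  exists (inl (if enter o p then arc p else p, true)) => /=.
  by case: (state_stage _ _ _); case E: (enter o p); rewrite ?enter_arc E.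
apply/card_gt0P; exists (froot (step (state_diagram o set0 F)) d').
rewrite inE (roots_root (fconnect_sym (@step_inj _ _))).
exact: etrans (out_fconnect (connect_root _ _)) d'o.
Qed.

End Expansion.

Definition homfly_weight (G : ribbon_graph) (n b : nat) : fracXY :=
  (XX^-1 * YY) ^+ n * (XX^-1 ^+ 2) ^+ (#|edge G| - n) *
  ((XX - XX^-1) / YY) ^+ b.-1.

Lemma homfly_state_sum (G : ribbon_graph) (o : orientation G)
    (d : link_surface o) :
  P (link_diagram o) =
  state_sum (homfly_weight G) G.
Proof.
rewrite homfly_link; apply: eq_bigr => F _.
by rewrite prod_stage_weight (homfly_state F d).
Qed.

Lemma homfly_partial_dual (G : ribbon_graph) (A : {set edge G})
    (o : orientation G) (oA : orientation (partial_dual A)) :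
  P (link_diagram o) = P (link_diagram oA).
Proof.
case: (pickP {: link_dart G}) => [d _ | no_dart].
  rewrite (homfly_state_sum (d : link_surface o)).
  rewrite (homfly_state_sum (d : link_surface oA)).
  (* [homfly_weight] sees the graph only through its number of edges, which the partial dual
     shares. *)
  exact/esym/state_sum_dual.
(* For the empty ribbon graph both diagrams are empty, hence homeomorphic. *)
apply: (homfly_isotopic hP); apply: IsoHomeo; exists (id : link_dart G -> _).
have absurd (d : link_dart G) : False by have := no_dart d.
by split; split; try (by move=> d; case: (absurd d)); exists id.
Qed.

End Homfly.

Theorem lemma13 (P : forall S : surface, diagram S -> fracXY)
    (hP : is_homfly P) :
  (forall (G : ribbon_graph) (A : {set edge G}), orientable G ->
     forall (R : comUnitRingType) (sx sy z : R), sx * sy * z = 1 ->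
       (sy ^+ 2 * z) ^+ nvertices G * Rs G sx sy z =
       (sy ^+ 2 * z) ^+ nvertices (partial_dual A)
         * Rs (partial_dual A) sx sy z)
  <->
  (forall (G : ribbon_graph) (A : {set edge G})
     (o : orientation G) (oA : orientation (partial_dual A)),
       P (link_surface o) (link_diagram o) =
       P (link_surface oA) (link_diagram oA)).
Proof.
split=> _ G A; first by move=> o oA; apply: homfly_partial_dual hP _ _ _ _.
move=> _ R sx sy z sxyz.
by rewrite 2!(Rs_state_sum _ sxyz) ncomponents_dual state_sum_dual.
Qed.
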